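(* Let $\omega\in\Omega$, $y'\in Y$, and let $\mathcal{L}\subseteq[n]$ satisfy $f_\omega(\Delta(\mathcal{L},y'))=f_\omega(y')$. Then the strengthened cut $$\theta_\omega\;\geq\; f_\omega(y')-\sum_{\xi=y'_{\pi(\omega)}+1}^{y_{\max}}\bigl(f_\omega(y')-I_\omega(\xi)\bigr)z_{\pi(\omega)\xi}-\sum_{j\in\mathcal{L}\setminus\{\pi(\omega)\}}\ \sum_{\xi=y_j'+1}^{y_{\max}}\bigl(f_\omega(y')-\mathrm{Base}_\omega(y')\bigr)z_{j\xi}$$ is a valid Benders optimality cut on $(\omega,y')$. That is, writing $z_{j\xi}(y)=1$ if $y_j=\xi$ and $z_{j\xi}(y)=0$ otherwise, for every $y\in Y$ the value $f_\omega(y)$ is at least the right-hand side evaluated at $z=z(y)$, and equality holds at $y=y'$.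
   Context: Let $n$ be a positive integer, $[n]=\{1,\dots,n\}$, and let $y_{\min}\le y_{\max}$ be non-negative integers. The problem considered is $$\min_y\ g(y)+\sum_{\omega\in\Omega}f_\omega(y)\quad\text{subject to } y\in Y,$$ where $\Omega$ is a finite set, $Y\subseteq\{y_{\min},\dots,y_{\max}\}^n\subseteq\mathbb{Z}_+^n$ is a finite set, $g:\mathbb{Z}_+^n\to\mathbb{R}$ is a function, and for each $\omega\in\Omega$, $f_\omega:\mathbb{Z}_+^n\to\mathbb{R}_+$ is a bounded function that is non-increasing in each of the variables ($\mathbb{Z}_+$, $\mathbb{R}_+$ denote the non-negative integers and reals). A function $\pi:\Omega\to[n]$ is given (associating an object $\pi(\omega)$ with each $\omega$). In the master problem, each $f_\omega(y)$ is replaced by a continuous variable $\theta_\omega$, and binary variables $z_{j\xi}$ ($j\in[n]$, $\xi\in\{y_{\min},\dots,y_{\max}\}$) are introduced with $z_{j\xi}=1$ if and only if $y_j=\xi$, via the constraints $\sum_{\xi} z_{j\xi}=1$ and $\sum_\xi \xi z_{j\xi}=y_j$ for all $j\in[n]$. A Benders optimality cut on $(\omega,y')$ is an inequality $\theta_\omega\ge B(y)$ such that $B(y)\le f_\omega(y)$ for all $y\in Y$, with equality at $y=y'$. For $y\in\mathbb{Z}_+^n$ and $\mathcal{L}\subseteq[n]$, $\Delta(\mathcal{L},y)\in\mathbb{Z}_+^n$ denotes the vector obtained from $y$ by replacing $y_j$ by $y_{\max}$ for all $j\in[n]\setminus\mathcal{L}$ (and leaving $y_j$ unchanged for $j\in\mathcal{L}$).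 With $e_j$ the $j$th standard basis vector, define for $\xi\in\{y_{\min},\dots,y_{\max}\}$ $$I_\omega(\xi)=f_\omega\bigl(\Delta(\{\pi(\omega)\},\xi e_{\pi(\omega)})\bigr),\qquad \mathrm{Base}_\omega(y')=f_\omega\bigl(\Delta(\{\pi(\omega)\},y'_{\pi(\omega)}e_{\pi(\omega)})\bigr),$$ i.e. the value of $f_\omega$ when coordinate $\pi(\omega)$ equals $\xi$ (respectively $y'_{\pi(\omega)}$) and all other coordinates equal $y_{\max}$. Empty sums are zero. *)

(* Defs.v *)
From HB Require Import structures.
From mathcomp Require Import all_boot all_order all_algebra.
From mathcomp Require Import all_classical all_reals all_analysis.
Set Implicit Arguments.
Unset Strict Implicit.
Unset Printing Implicit Defensive.
Import Order.TTheory GRing.Theory Num.Theory.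
Import numFieldNormedType.Exports.
Local Open Scope ring_scope.

(* Points of Z_+^n are row vectors over nat. *)

Definition nonincreasing_in_each_variable (R : realType) (n : nat)
    (h : 'rV[nat]_n -> R) : Prop :=
  forall (j : 'I_n) (y y' : 'rV[nat]_n),
    (forall i : 'I_n, i != j -> y ord0 i = y' ord0 i) ->
    (y ord0 j <= y' ord0 j)%N -> h y' <= h y.

Definition Delta (n ymax : nat) (L : {set 'I_n}) (y : 'rV[nat]_n) :
    'rV[nat]_n :=
  \row_(j < n) (if j \in L then y ord0 j else ymax).

(* For h = f_w and p = pi(w), I_w(xi) is [Ival ymax h p xi]. *)
Definition Ival (R : realType) (n ymax : nat) (h : 'rV[nat]_n -> R)
    (p : 'I_n) (xi : nat) : R :=
  h (Delta ymax [set p]%SET (xi *: delta_mx ord0 p)).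

(* For h = f_w and p = pi(w), Base_w(y') is [Base ymax h p y']. *)
Definition Base (R : realType) (n ymax : nat) (h : 'rV[nat]_n -> R)
    (p : 'I_n) (y' : 'rV[nat]_n) : R :=
  h (Delta ymax [set p]%SET (y' ord0 p *: delta_mx ord0 p)).

(* The value at y of the binary variable z_{j,xi}. *)
Definition zval (R : realType) (n : nat) (y : 'rV[nat]_n) (j : 'I_n)
    (xi : nat) : R :=
  if y ord0 j == xi then 1 else 0.

(* The inequality theta_w >= B(y), with h = f_w, is identified with its
   right-hand side B. *)
Definition benders_optimality_cut (R : realType) (n : nat)
    (Y : set 'rV[nat]_n) (h : 'rV[nat]_n -> R) (y' : 'rV[nat]_n)
    (B : 'rV[nat]_n -> R) : Prop :=
  (forall y : 'rV[nat]_n, Y y -> B y <= h y) /\ B y' = h y'.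

(* Main.v *)
Require Import Defs.
From HB Require Import structures.
From mathcomp Require Import all_boot all_order all_algebra.
From mathcomp Require Import all_classical all_reals all_analysis.
Set Implicit Arguments.
Unset Strict Implicit.
Unset Printing Implicit Defensive.
Import Order.TTheory GRing.Theory Num.Theory.
Import numFieldNormedType.Exports.
Local Open Scope ring_scope.

(** Since each [y_j] takes exactly one value, the sum over [xi] attached to [j]
    retains at most one coefficient, the one at [xi = y_j], and retains it
    exactly when [y_j] exceeds [y'_j] ([sum_zval]).  At [y = y'] nothing is subtracted,
    whence equality.

    For validity put [p = pi w] and [v = f w y'].  A function non-increasing in
    each variable is antitone for the coordinatewise order
    ([antitone_coordinatewise]), so enlarging the coordinates away from [p] to
    [ymax] can only lower its value ([Ival_le]).  In particular [Base <= v],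
    and all terms of the double sum are nonnegative.  Three cases remain.
    - If [y_p > y'_p], the first sum replaces [v] by [I(y_p)], which is at most
      [f w y]; the double sum only lowers the bound further.
    - If [y_p <= y'_p] and [y_j > y'_j] for some [j] in [L] other than [p], the
      term of that [j] alone lowers the bound to [Base], which is at most
      [f w y], because [y] lies below the point defining [Base].
    - Otherwise [y_j <= y'_j] on [L], so [y] lies below [Delta L y'], and
      [f w y >= f w (Delta L y') = v]: this is where the choice of [L] enters. *)

(** The two points are joined by a path that changes one coordinate at a time:
    the hybrid point after [k] steps agrees with [y] in the first [k]
    coordinates and with [y'] in the others. *)
Lemma antitone_coordinatewise (R : realType) (n : nat) (h : 'rV[nat]_n -> R)
    (y y' : 'rV[nat]_n) :
  nonincreasing_in_each_variable h ->
  (forall i, (y ord0 i <= y' ord0 i)%N) -> h y' <= h y.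
Proof.
move=> hmono le_yy'.
pose hybrid k : 'rV[nat]_n :=
  \row_(i < n) (if (i < k)%N then y ord0 i else y' ord0 i).
have hybridn : hybrid n = y by apply/rowP => i; rewrite mxE ltn_ord.
rewrite -[in leRHS]hybridn.
have: (n <= n)%N by [].
elim: {-2}n => [_|k IHk lt_kn].
  by rewrite (_ : hybrid 0%N = y') //; apply/rowP => i; rewrite mxE.
apply: le_trans (IHk (ltnW lt_kn)) _.
apply: (hmono (Ordinal lt_kn)) => [i ne_ik|]; rewrite !mxE /=.
- have {}ne_ik : (i : nat) != k by [].
  by rewrite ltnS leq_eqVlt (negbTE ne_ik).
- by rewrite ltnSn ltnn.
Qed.

(** With the coordinate of [p] raised to [xi] and all others to [ymax], the
    point defining [Ival] dominates [y].  As [Base ymax h p y'] is by definition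
    [Ival] at [y' ord0 p], this bounds [Base] as well. *)
Lemma Ival_le (R : realType) (n ymax : nat) (h : 'rV[nat]_n -> R) (p : 'I_n)
    (xi : nat) (y : 'rV[nat]_n) :
  nonincreasing_in_each_variable h ->
  (forall j, (y ord0 j <= ymax)%N) -> (y ord0 p <= xi)%N ->
  Ival ymax h p xi <= h y.
Proof.
move=> hmono y_le yp_le; apply: antitone_coordinatewise => // i.
rewrite !mxE finset.in_set1; case: eqVneq => [->|_] //.
by rewrite !eqxx mulr1.
Qed.

Lemma sum_zval (R : realType) (n ymax a : nat) (F : nat -> R)
    (y : 'rV[nat]_n) (j : 'I_n) :
  (y ord0 j <= ymax)%N ->
  \sum_(a.+1 <= xi < ymax.+1) F xi * zval R y j xi
    = if (a < y ord0 j)%N then F (y ord0 j) else 0.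
Proof.
move=> y_le.
rewrite (eq_bigr (fun xi => if xi == y ord0 j then F xi else 0)); last first.
  by move=> xi _; rewrite /zval eq_sym; case: eqP; rewrite ?mulr1 ?mulr0.
by rewrite -big_mkcond big_nat1_eq ltnS y_le andbT.
Qed.

Theorem mainTheorem3 (R : realType) (n : nat) (n_gt0 : (0 < n)%N)
    (ymin ymax : nat) (le_ymin_ymax : (ymin <= ymax)%N)
    (Omega : finType) (Y : set 'rV[nat]_n) (Y_finite : finite_set Y)
    (Y_box : forall y : 'rV[nat]_n, Y y ->
       forall j : 'I_n, (ymin <= y ord0 j <= ymax)%N)
    (g : 'rV[nat]_n -> R) (f : Omega -> 'rV[nat]_n -> R)
    (f_ge0 : forall (w : Omega) (y : 'rV[nat]_n), 0 <= f w y)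
    (f_bounded : forall w : Omega, bounded_fun (f w))
    (f_nonincreasing : forall w : Omega,
       nonincreasing_in_each_variable (f w))
    (pi : Omega -> 'I_n)
    (w : Omega) (y' : 'rV[nat]_n) (Yy' : Y y') (L : {set 'I_n})
    (f_Delta : f w (Delta ymax L y') = f w y') :
  benders_optimality_cut Y (f w) y' (fun y : 'rV[nat]_n =>
    f w y'
    - \sum_((y' ord0 (pi w)).+1 <= xi < ymax.+1)
        (f w y' - Ival ymax (f w) (pi w) xi) * zval R y (pi w) xi
    - \sum_(j in L :\ pi w) \sum_((y' ord0 j).+1 <= xi < ymax.+1)
        (f w y' - Base ymax (f w) (pi w) y') * zval R y j xi).
Proof.
set p := pi w; set v := f w y'; set b := Base ymax (f w) p y'.
have mono := f_nonincreasing w.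
have Y_le y : Y y -> forall j, (y ord0 j <= ymax)%N.
  by move=> Yy j; case/andP: (Y_box y Yy j).
have b_le_v : b <= v by apply: Ival_le => //; exact: Y_le.
split=> [y Yy|]; last first.
  rewrite sum_zval; last exact: Y_le.
  rewrite ltnn subr0 big1 ?subr0 // => j _.
  by rewrite (sum_zval _ (fun=> v - b)) ?ltnn //; exact: Y_le.
have y_le := Y_le y Yy.
rewrite sum_zval //.
under eq_bigr => j _ do rewrite (sum_zval _ (fun=> v - b)) //.
have term_ge0 j : 0 <= (if (y' ord0 j < y ord0 j)%N then v - b else 0).
  by case: ifP => // _; rewrite subr_ge0.
case: (ltnP (y' ord0 p) (y ord0 p)) => [_|yp_le].
  rewrite subKr; apply: (@le_trans _ _ (Ival ymax (f w) p (y ord0 p))).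
    by rewrite gerBl sumr_ge0.
  exact: Ival_le.
rewrite subr0.
case: (boolP [exists j in L :\ p, (y' ord0 j < y ord0 j)%N]).
  case/exists_inP => j jL lt_j.
  apply: (@le_trans _ _ b); last exact: Ival_le.
  rewrite (bigD1 j) //= lt_j opprD addrA subKr.
  by rewrite gerBl sumr_ge0.
move/exists_inPn => no_larger.
rewrite big1 => [|j jL]; last by rewrite (negbTE (no_larger j jL)).
rewrite subr0 /v -f_Delta; apply: antitone_coordinatewise => // j.
rewrite mxE; case: ifP => // jL.
have [->//|ne_jp] := eqVneq j p.
by rewrite leqNgt no_larger // finset.in_setD1 ne_jp.
Qed.
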